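(* Let $n\ge 1$ be the number of surfaces and suppose the current game between players $i$ and $j$ is played on surface $m\in\{1,\dots,n\}$. Let $\Lambda_i=(\sigma_{kl})_{k,l=1}^n$ and $\Lambda_j=(\tau_{kl})_{k,l=1}^n$ be the prior covariance matrices of the two players, $\Sigma=\begin{bmatrix}\Lambda_i & 0 \\ 0 & \Lambda_j\end{bmatrix}$, and write $\sigma_m^2=\sigma_{mm}$, $\tau_m^2=\tau_{mm}$. Let $\boldsymbol\theta\in\mathbb R^{2n}$, let $H=H(\boldsymbol\theta)=-\Sigma^{-1}+D$ be the Hessian at $\boldsymbol\theta$ of the log-posterior $\ell$ (with $D=D(\boldsymbol\theta)$; see context), and let $d=-b^2p_{ij}p_{ji}$, where $p_{ij}=p_{ij}(\boldsymbol\theta)$ and $p_{ji}=1-p_{ij}$. Then $$-H^{-1}=\Sigma+W,$$ where $W$ is the $2n\times 2n$ matrix given in $n\times n$ blocks by $$W=\frac{d}{\det(I-D\Sigma)}\begin{bmatrix} W^{11} & W^{12} \\ W^{21} & W^{22} \end{bmatrix},$$ with, for $k,l\in\{1,\dots,n\}$, $$W^{11}_{kl}=\sigma_{km}\sigma_{ml},\qquad W^{12}_{kl}=-\sigma_{km}\tau_{ml},\qquad W^{21}_{kl}=-\tau_{km}\sigma_{ml},\qquad W^{22}_{kl}=\tau_{km}\tau_{ml},$$ and $$\det(I-D\Sigma)=1-d(\sigma_{mm}+\tau_{mm})=1+b^2p_{ij}p_{ji}(\sigma_m^2+\tau_m^2).$$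
   Context: Setting. There are $n$ types of playing surfaces. Players $i$ and $j$ have strength vectors $\boldsymbol\theta_i=(\theta_{i1},\dots,\theta_{in})^T$ and $\boldsymbol\theta_j=(\theta_{j1},\dots,\theta_{jn})^T$ with independent normal priors $N(\boldsymbol\mu_i,\Lambda_i)$ and $N(\boldsymbol\mu_j,\Lambda_j)$, where $\Lambda_i,\Lambda_j$ are $n\times n$ symmetric positive definite covariance matrices. Put $\boldsymbol\theta=(\boldsymbol\theta_i^T,\boldsymbol\theta_j^T)^T\in\mathbb R^{2n}$, $\boldsymbol\mu=(\boldsymbol\mu_i^T,\boldsymbol\mu_j^T)^T$, so $\boldsymbol\theta\sim N(\boldsymbol\mu,\Sigma)$ with $\Sigma=\mathrm{diag}(\Lambda_i,\Lambda_j)$. Let $b=\log(10)/400$. If the game is played on surface $m$, the win probability of $i$ against $j$ is $p_{ij}(\boldsymbol\theta)=e^{b\theta_{im}}/(e^{b\theta_{im}}+e^{b\theta_{jm}})$, and $p_{ji}(\boldsymbol\theta)=1-p_{ij}(\boldsymbol\theta)$. The outcome is $s_{ij}\in\{0,1\}$, with $s_{ij}=1$ if $i$ wins and $s_{ij}=0$ if $i$ loses. The log-posterior (up to an additive constant) is $$\ell(\boldsymbol\theta)=-\tfrac12(\boldsymbol\theta-\boldsymbol\mu)^T\Sigma^{-1}(\boldsymbol\theta-\boldsymbol\mu)+s_{ij}\log p_{ij}(\boldsymbol\theta)+(1-s_{ij})\log(1-p_{ij}(\boldsymbol\theta)).$$ Its gradient is $J(\boldsymbol\theta)=\nabla\ell(\boldsymbol\theta)=-\Sigma^{-1}(\boldsymbol\theta-\boldsymbol\mu)+\boldsymbol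 v$, where $\boldsymbol v=\boldsymbol v(\boldsymbol\theta)\in\mathbb R^{2n}$ has exactly two nonzero entries, $v_m=b(s_{ij}p_{ji}-(1-s_{ij})p_{ij})$ and $v_{n+m}=-v_m$. Its Hessian is $H(\boldsymbol\theta)=\nabla^2\ell(\boldsymbol\theta)=-\Sigma^{-1}+D$, where $D=D(\boldsymbol\theta)$ is the $2n\times 2n$ matrix whose $k$th row is the gradient of $v_k$; its nonzero entries are $D_{m,m}=D_{n+m,n+m}=-b^2p_{ij}p_{ji}$ and $D_{m,n+m}=D_{n+m,m}=b^2p_{ij}p_{ji}$. *)

(* Defs.v *)
From HB Require Import structures.
From mathcomp Require Import all_boot all_order all_algebra.
From mathcomp Require Import all_classical all_reals all_analysis.

Set Implicit Arguments.
Unset Strict Implicit.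
Unset Printing Implicit Defensive.

Import Order.TTheory GRing.Theory Num.Theory.
Import numFieldNormedType.Exports.

Local Open Scope ring_scope.

Definition sym_posdef (R : realType) (n : nat) (A : 'M[R]_n) : Prop :=
  A^T = A /\ forall x : 'cV[R]_n, x != 0 -> 0 < (x^T *m A *m x) 0 0.

Definition gradient (R : realType) (N : nat) (f : 'cV[R]_N -> R)
    (x : 'cV[R]_N) : 'cV[R]_N :=
  \col_k 'D_(delta_mx k 0) f x.

(* The library's 'J acts on row vectors and is the transpose of this matrix:
   here row k is the gradient of the k-th component. *)
Definition jacobian_mx (R : realType) (N : nat) (F : 'cV[R]_N -> 'cV[R]_N)
    (x : 'cV[R]_N) : 'M[R]_N :=
  \matrix_(k, l) gradient (fun y => F y k 0) x l 0.

Definition hessian (R : realType) (N : nat) (f : 'cV[R]_N -> R)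
    (x : 'cV[R]_N) : 'M[R]_N :=
  jacobian_mx (gradient f) x.

Section Model.
Context {R : realType} {n : nat}.
Implicit Types (mu_i mu_j : 'cV[R]_n) (Lambda_i Lambda_j : 'M[R]_n).
Implicit Types (m : 'I_n) (s : bool) (theta : 'cV[R]_(n + n)).

(* Scale of the Elo rating system. *)
Definition elo_b : R := ln 10 / 400.

(* theta stacks the strengths of players i and j, so that theta_im and theta_jm
   are its entries at lshift n m and rshift n m. *)
Definition win_prob m theta : R :=
  expR (elo_b * theta (lshift n m) 0) /
  (expR (elo_b * theta (lshift n m) 0) + expR (elo_b * theta (rshift n m) 0)).

Definition loss_prob m theta : R := 1 - win_prob m theta.

Definition prior_cov Lambda_i Lambda_j : 'M[R]_(n + n) :=
  block_mx Lambda_i 0 0 Lambda_j.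

(* The log-posterior up to an additive constant; s is true iff i wins. *)
Definition log_posterior mu_i mu_j Lambda_i Lambda_j m s theta : R :=
  let mu := col_mx mu_i mu_j in
  - (1 / 2) * ((theta - mu)^T *m invmx (prior_cov Lambda_i Lambda_j)
               *m (theta - mu)) 0 0
  + s%:R * ln (win_prob m theta) + (1 - s%:R) * ln (1 - win_prob m theta).

(* The likelihood part v of the gradient
   - Sigma^-1 (theta - mu) + v of the log-posterior. *)
Definition score m s theta : 'cV[R]_(n + n) :=
  let vm := elo_b * (s%:R * loss_prob m theta
                     - (1 - s%:R) * win_prob m theta) in
  \col_k (if k == lshift n m then vm
          else if k == rshift n m then - vm else 0).

End Model.

(* Main.v *)
(* With u = e_m - e_(n+m), the strengths enter the likelihood only through
   u^T theta, so the Hessian of the log-likelihood is the rank-one matrix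
   D = d u u^T. Then - H = Sigma^-1 - d u u^T is inverted by the
   Sherman-Morrison formula, whose denominator 1 - d (u^T Sigma u) equals
   det (1 - D Sigma), and is at least 1 because d <= 0. *)
Require Import Defs.
From mathcomp Require Import all_boot all_order all_algebra.
From mathcomp Require Import all_classical all_reals all_analysis.
From mathcomp Require Import ring.

Import Order.TTheory GRing.Theory Num.Theory.
Import numFieldNormedType.Exports.

Local Open Scope ring_scope.

(** * Rank-one updates: determinant and inverse *)

(* Both determinants are those of the Schur complements in [[1, A], [B, 1]]. *)
Lemma det_one_sub_mulmxC (R : comUnitRingType) (p q : nat)
    (A : 'M[R]_(p, q)) (B : 'M[R]_(q, p)) :
  \det (1%:M - A *m B) = \det (1%:M - B *m A).
Proof.
pose M := block_mx 1%:M A B 1%:M.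
have E1 : M *m block_mx 1%:M 0 (- B) 1%:M = block_mx (1%:M - A *m B) A 0 1%:M.
  by rewrite mulmx_block !(mulmx1, mul1mx, mulmx0, mulmxN) subrr !add0r.
have E2 : M *m block_mx 1%:M (- A) 0 1%:M = block_mx 1%:M 0 B (1%:M - B *m A).
  by rewrite mulmx_block !(mulmx1, mul1mx, mulmx0, mulmxN) !addr0 addNr
    [- _ + _]addrC.
move: (congr1 determinant E1) (congr1 determinant E2).
by rewrite !det_mulmx !det_lblock !det_ublock !det1 !(mulr1, mul1r) => <- <-.
Qed.

(** The product expands to [1%:M] plus [c - d - d * c * q] times [u *m (u^T *m S)], where
    [c = d / (1 - d * q)], and this coefficient vanishes. *)
Lemma mulmx_sherman_morrison (F : fieldType) (N : nat) (S : 'M[F]_N)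
    (u : 'cV[F]_N) (d : F) :
  let q := (u^T *m S *m u) 0 0 in
  S \in unitmx -> 1 - d * q != 0 ->
  (invmx S - d *: (u *m u^T)) *m
    (S + (d / (1 - d * q)) *: (S *m u *m (u^T *m S))) = 1%:M.
Proof.
move=> q US q0.
have qE : u^T *m S *m u = q%:M by rewrite [LHS]mx11_scalar.
have E : u *m u^T *m (S *m u *m (u^T *m S)) = q *: (u *m (u^T *m S)).
  rewrite -!mulmxA (mulmxA u^T S (u *m _)) (mulmxA _ u) qE.
  by rewrite mul_scalar_mx -scalemxAr.
rewrite mulmxDr !mulmxBl mulVmx // -!scalemxAr -!scalemxAl E.
rewrite -!(mulmxA S) mulKmx // -mulmxA.
set Y := u *m _.
rewrite !scalerA -scalerBl -addrA -[RHS]addr0; congr (_ + _).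
rewrite -scaleNr -scalerDl; apply/eqP; rewrite scaler_eq0; apply/orP; left.
by apply/eqP; field.
Qed.

(** * Directional derivatives by restriction to a line *)

(** Both difference quotients are the same function of the step. This lets one-variable rules, the
    chain rule above all, serve functions of a vector. *)
Lemma is_derive_line (R : numFieldType) (V W : normedModType R) (f : V -> W)
    (x v : V) (df : W) :
  is_derive x v f df <-> is_derive (0 : R) 1 (fun h : R => f (h *: v + x)) df.
Proof.
have E : 'D_v f x = 'D_1 (fun h : R => f (h *: v + x)) 0.
  rewrite /derive; set g1 := fun h => h^-1 *: _; set g2 := fun h => h^-1 *: _.
  suff -> : g1 = g2 by [].
  by apply/funext => h; rewrite /g1 /g2 /= addr0 scale0r add0r [_%:A]mulr1.
split=> -[D <-]; apply: DeriveDef; rewrite ?E //.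
  exact: (derivable1P f x v).1 D.
exact: (derivable1P f x v).2 D.
Qed.

(** On the line, [f] is a polynomial in [h], and its derivative at 0 is the linear coefficient. This
    covers the Gaussian term and, with [b = 0], affine functions. *)
Lemma is_derive_quadratic (R : realType) (V : normedModType R) (f : V -> R)
    (x v : V) (a b : R) :
  (forall h : R, f (h *: v + x) = f x + h * a + h ^+ 2 * b) ->
  is_derive x v f a.
Proof.
move=> fE; apply/is_derive_line.
rewrite (_ : (fun h => _) = cst (f x) + (id * cst a) + (id ^+ 2) * cst b);
  last by apply/funext => h; rewrite fE.
apply: is_derive_eq; rewrite /= !scaler0 /=.
by rewrite /cst /GRing.scale/=; ring.
Qed.

Lemma is_derive_comp1 {R : realType} {V : normedModType R} {f : V -> R}
    {g : R -> R} {x v : V} {df dg : R} :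
  is_derive (f x) 1 g dg -> is_derive x v f df ->
  is_derive x v (g \o f) (dg * df).
Proof.
move=> Dg /is_derive_line Df; apply/is_derive_line.
by apply: (is_derive1_comp _ Df); rewrite scale0r add0r.
Qed.

Lemma quadratic_form_line (R : comNzRingType) (N : nat) (P : 'M[R]_N)
    (v z : 'cV[R]_N) (h : R) :
  P^T = P ->
  ((h *: v + z)^T *m P *m (h *: v + z)) 0 0 =
    (z^T *m P *m z) 0 0 + h * ((v^T *m P *m z) 0 0 *+ 2)
      + h ^+ 2 * (v^T *m P *m v) 0 0.
Proof.
move=> PT.
(* A 1 x 1 matrix equals its transpose, so symmetry of [P] merges the two cross terms. *)
have zv : (z^T *m P *m v) 0 0 = (v^T *m P *m z) 0 0.
  rewrite -[in RHS](trmxK (v^T *m P *m z)) [in RHS]mxE.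
  by rewrite !trmx_mul trmxK PT mulmxA.
have -> : (h *: v + z)^T = h *: v^T + z^T by rewrite linearP.
rewrite !(mulmxDl, mulmxDr) -!(scalemxAl, scalemxAr).
move: zv; move: (_ *m v) (_ *m z) (_ *m v) (_ *m z) => A B C E.
by rewrite !mxE => ->; ring.
Qed.

(** * Derivatives of the win probability, log-likelihood and score *)

Section WinProbability.
Context {R : realType} {n : nat}.
Implicit Types (m : 'I_n) (x v : 'cV[R]_(n + n)).

Lemma win_probE m x :
  win_prob m x =
    (1 + expR (- (elo_b * (x (lshift n m) 0 - x (rshift n m) 0))))^-1.
Proof.
rewrite /win_prob mulrBr opprB expRD expRN.
set A := expR (_ * x (lshift _ _) _); set B := expR _.
have A0 : A != 0 by rewrite gt_eqF ?expR_gt0.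
have AB0 : A + B != 0 by rewrite gt_eqF ?addr_gt0 ?expR_gt0.
by field; rewrite A0 AB0.
Qed.

Lemma win_prob_gt0 m x : 0 < win_prob m x.
Proof. by rewrite win_probE invr_gt0 addr_gt0 ?expR_gt0. Qed.

Lemma loss_prob_gt0 m x : 0 < loss_prob m x.
Proof.
by rewrite /loss_prob win_probE subr_gt0 invf_lt1 ?ltrDl ?addr_gt0 ?expR_gt0.
Qed.

(** The logistic function satisfies p' = p (1 - p); the remaining factors differentiate its linear
    argument. *)
Lemma is_derive_win_prob m x v :
  is_derive x v (win_prob m)
    (elo_b * win_prob m x * loss_prob m x *
       (v (lshift n m) 0 - v (rshift n m) 0)).
Proof.
pose f (y : 'cV[R]_(n + n)) : R :=
  - (elo_b * (y (lshift n m) 0 - y (rshift n m) 0)).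
pose g (t : R) := (1 + expR t)^-1.
have wE : win_prob m = g \o f by apply/funext => y; rewrite win_probE.
have Df : is_derive x v f (f v).
  apply: (@is_derive_quadratic _ _ _ _ _ _ 0) => h.
  by rewrite /f !mxE; ring.
have e0 : 1 + expR (f x) != 0 by rewrite gt_eqF ?addr_gt0 ?expR_gt0.
have Dg : is_derive (f x) 1 g (- (1 + expR (f x)) ^- 2 * expR (f x)).
  have D1 : is_derive (f x) 1 (cst 1 + expR) (expR (f x)).
    by apply: is_derive_eq; rewrite add0r.
  exact: (@is_deriveV _ (cst 1 + expR) _ _ _ e0 D1).
have := is_derive_comp1 Dg Df; rewrite -wE => D; apply: is_derive_eq D _.
rewrite /loss_prob win_probE -/(f x) {3}/f; field.
exact: e0.
Qed.


(** Dividing the derivative of p by p, or that of 1 - p by 1 - p, cancels one factor of p (1 -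
    p). *)
Lemma is_derive_log_likelihood m (s : bool) x v :
  is_derive x v
    (fun y => s%:R * ln (win_prob m y) + (1 - s%:R) * ln (1 - win_prob m y))
    (elo_b * (s%:R * loss_prob m x - (1 - s%:R) * win_prob m x) *
       (v (lshift n m) 0 - v (rshift n m) 0)).
Proof.
have p0 := win_prob_gt0 m x; have q0 := loss_prob_gt0 m x.
have Dp := is_derive_win_prob m x v.
have Dq : is_derive x v (cst 1 - win_prob m) 
    (0 - elo_b * win_prob m x * loss_prob m x *
     (v (lshift n m) 0 - v (rshift n m) 0)).
  exact: is_deriveB.
have Dlp := is_derive_comp1 (is_derive1_ln p0) Dp.
have Dlq := is_derive_comp1
  (is_derive1_ln q0 : is_derive ((cst 1 - win_prob m) x) 1 _ _) Dq.
apply: is_derive_eq (is_deriveD (is_deriveZ s%:R Dlp)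
  (is_deriveZ (1 - s%:R) Dlq)) _.
rewrite /GRing.scale /=; field.
by rewrite !gt_eqF.
Qed.

Lemma is_derive_score m (s : bool) x v k :
  is_derive x v (fun y => score m s y k 0)
    (- (elo_b ^+ 2 * win_prob m x * loss_prob m x) *
       (v (lshift n m) 0 - v (rshift n m) 0) *
       ((k == lshift n m)%:R - (k == rshift n m)%:R)).
Proof.
(* [c] is entry [k] of u. As s (1 - p) - (1 - s) p = s - p, entry [k] of the score is [elo_b * c]
   times s - p, affine in [win_prob m]. *)
set c := (_ - _ in X in _ * X).
rewrite (_ : (fun y => _) = (elo_b * c * s%:R) \*: cst 1
    + (- (elo_b * c)) \*: win_prob m); last first.
  apply/funext => y; rewrite /score mxE.
  rewrite [RHS](_ : _ = elo_b * c * s%:R * 1 + - (elo_b * c) * win_prob m y) //.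
  rewrite /c /loss_prob; have [->|_] := eqVneq k (lshift n m).
    by rewrite eq_lrshift /=; ring.
  by case: (k == rshift n m) => /=; ring.
have Dp := is_derive_win_prob m x v.
apply: is_derive_eq; rewrite /GRing.scale /=; ring.
Qed.

End WinProbability.

(** * Gradient and Hessian of the log-posterior *)

Lemma gradient_log_posterior (R : realType) (n : nat) (mu_i mu_j : 'cV[R]_n)
    (sigma tau : 'M[R]_n) (m : 'I_n) (s : bool) (x : 'cV[R]_(n + n)) :
  let P := invmx (prior_cov sigma tau) in
  P^T = P ->
  gradient (log_posterior mu_i mu_j sigma tau m s) x =
    - (P *m (x - col_mx mu_i mu_j)) + score m s x.
Proof.
move=> P PT; set mu := col_mx _ _; apply/colP => k; rewrite mxE.
set v := delta_mx k 0; apply: derive_val.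
have D1 : is_derive x v
    (fun y => - (1 / 2) * ((y - mu)^T *m P *m (y - mu)) 0 0)
    (- (P *m (x - mu)) k 0).
  apply: (@is_derive_quadratic _ _ _ _ _ _ (- (1 / 2) * (v^T *m P *m v) 0 0)).
  (* As [v] is a basis vector, the linear coefficient of the quadratic form picks out one entry. *)
  have vz : (v^T *m P *m (x - mu)) 0 0 = (P *m (x - mu)) k 0.
    by rewrite -mulmxA trmx_delta -rowE mxE.
  by move=> h; rewrite -addrA quadratic_form_line // vz; field.
have D := is_deriveD D1 (is_derive_log_likelihood m s x v).
rewrite (_ : log_posterior _ _ _ _ _ _ =
  (fun y => - (1 / 2) * ((y - mu)^T *m P *m (y - mu)) 0 0) +
  (fun y => s%:R * ln (win_prob m y) + (1 - s%:R) * ln (1 - win_prob m y)));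
  last by apply/funext => y; rewrite /log_posterior -addrA.
apply: is_derive_eq D _.
rewrite [RHS]mxE [X in _ = X + _]mxE; congr (_ + _).
rewrite /score /v !mxE !eqxx !andbT.
rewrite (eq_sym (lshift _ _)) (eq_sym (rshift _ _)).
have [->|_] := eqVneq k (lshift n m).
  by rewrite eq_lrshift subr0 mulr1.
by case: (k == rshift n m); rewrite /= ?subrr ?sub0r ?mulrN1 ?mulr0.
Qed.

(** The score is u times a scalar in which the outcome [s] is only an additive constant, so [s]
    drops out on differentiating. *)
Lemma jacobian_score (R : realType) (n : nat) (m : 'I_n) (s : bool)
    (x : 'cV[R]_(n + n)) :
  let u : 'cV[R]_(n + n) := delta_mx (lshift n m) 0 - delta_mx (rshift n m) 0 in
  jacobian_mx (score m s) x =
    - (elo_b ^+ 2 * win_prob m x * loss_prob m x) *: (u *m u^T).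
Proof.
move=> u; apply/matrixP => k l.
have -> : jacobian_mx (score m s) x k l =
    'D_(delta_mx l 0) (fun y => score m s y k 0) x by rewrite !mxE.
rewrite (derive_val (is_derive := is_derive_score m s x (delta_mx l 0) k)).
rewrite [RHS]mxE [(u *m _) _ _]mxE big_ord1 /u !mxE !eqxx !andbT.
rewrite (eq_sym (lshift _ _)) (eq_sym (rshift _ _)); ring.
Qed.

Lemma hessian_log_posterior (R : realType) (n : nat) (mu_i mu_j : 'cV[R]_n)
    (sigma tau : 'M[R]_n) (m : 'I_n) (s : bool) (x : 'cV[R]_(n + n)) :
  let P := invmx (prior_cov sigma tau) in
  P^T = P ->
  hessian (log_posterior mu_i mu_j sigma tau m s) x =
    - P + jacobian_mx (score m s) x.
Proof.
move=> P PT; apply/matrixP => k l; rewrite mxE [RHS]mxE.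
rewrite (_ : (jacobian_mx _ _) k l =
    'D_(delta_mx l 0) (fun y => score m s y k 0) x); last by rewrite !mxE.
rewrite mxE.
have D1 : is_derive x (delta_mx l 0)
    (fun y => (- (P *m (y - col_mx mu_i mu_j))) k 0) ((- P) k l).
  apply: (@is_derive_quadratic _ _ _ _ _ _ 0) => h.
  rewrite -addrA mulmxDr -scalemxAr -colE opprD -scalerN.
  by move: (P *m (x - _)) => y; rewrite !mxE mulr0 addr0 addrC.
have D2 := is_derive_score m s x (delta_mx l 0) k.
rewrite (derive_val (is_derive := D2)).
rewrite -(derive_val (is_derive := is_deriveD D1 D2)).
(* The gradient formula holds at every point [y], so it may be substituted under the derivative. *)
by congr ('D__ _ _); apply/funext => y; rewrite gradient_log_posterior // mxE.
Qed.


(** * Positive definiteness and the final inversion *)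

(** A nonzero row [v] with [v *m A^T = 0] would make the quadratic form vanish at [v^T]. *)
Lemma sym_posdef_unitmx (R : realType) (n : nat) (A : 'M[R]_n) :
  sym_posdef A -> A \in unitmx.
Proof.
move=> [_ Apos]; rewrite -unitmx_tr -row_free_unit -kermx_eq0.
apply/rowV0P => v /sub_kermxP vA; apply/eqP/negPn/negP => v0.
have := Apos v^T; rewrite trmx_eq0 v0 => /(_ isT).
by rewrite trmxK -mulmxA -[A]trmxK -trmx_mul vA trmx0 mulmx0 mxE ltxx.
Qed.

Lemma sym_posdef_diag_ge0 (R : realType) (n : nat) (A : 'M[R]_n) (k : 'I_n) :
  sym_posdef A -> 0 <= A k k.
Proof.
move=> [_ Apos]; have : delta_mx k 0 != 0 :> 'cV[R]_n.
  by apply/eqP => /matrixP/(_ k 0); rewrite !mxE !eqxx => /eqP; rewrite oner_eq0.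
by move=> /Apos/ltW; rewrite trmx_delta -rowE -colE !mxE.
Qed.

Theorem proposition1 (R : realType) (n : nat) (hn : (1 <= n)%N) (m : 'I_n)
    (mu_i mu_j : 'cV[R]_n) (sigma tau : 'M[R]_n)
    (hsigma : sym_posdef sigma) (htau : sym_posdef tau)
    (s : bool) (theta : 'cV[R]_(n + n)) :
  let Sigma := prior_cov sigma tau in
  let H := hessian (log_posterior mu_i mu_j sigma tau m s) theta in
  let D := jacobian_mx (score m s) theta in
  let p_ij := win_prob m theta in
  let p_ji := loss_prob m theta in
  let d := - (elo_b ^+ 2 * p_ij * p_ji) in
  let W11 := \matrix_(k < n, l < n) (sigma k m * sigma m l) in
  let W12 := \matrix_(k < n, l < n) (- (sigma k m * tau m l)) in
  let W21 := \matrix_(k < n, l < n) (- (tau k m * sigma m l)) in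
  let W22 := \matrix_(k < n, l < n) (tau k m * tau m l) in
  let W := (d / \det (1%:M - D *m Sigma)) *: block_mx W11 W12 W21 W22 in
  [/\ H = - invmx Sigma + D,
      H \in unitmx,
      - invmx H = Sigma + W,
      \det (1%:M - D *m Sigma) = 1 - d * (sigma m m + tau m m) &
      1 - d * (sigma m m + tau m m)
        = 1 + elo_b ^+ 2 * p_ij * p_ji * (sigma m m + tau m m)].
Proof.
move=> Sigma H D p_ij p_ji d W11 W12 W21 W22 W.
have sigmaT := hsigma.1; have tauT := htau.1.
have ST : Sigma^T = Sigma by rewrite tr_block_mx !trmx0 sigmaT tauT.
have SU : Sigma \in unitmx.
  by rewrite unitmxE det_ublock unitrM -!unitmxE !sym_posdef_unitmx.
pose u : 'cV[R]_(n + n) := delta_mx (lshift n m) 0 - delta_mx (rshift n m) 0.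
have DE : D = d *: (u *m u^T) by apply: jacobian_score.
have HE : H = - invmx Sigma + D.
  by apply: hessian_log_posterior; rewrite trmx_inv ST.
have uE : u = col_mx (delta_mx m 0) (- delta_mx m 0).
  by rewrite /u delta_mx_ushift delta_mx_dshift opp_col_mx add_col_mx oppr0 addr0
    add0r.
have SuE : Sigma *m u = col_mx (col m sigma) (- col m tau).
  by rewrite uE mul_block_col !mul0mx addr0 add0r mulmxN -!colE.
have uSE : u^T *m Sigma = row_mx (row m sigma) (- row m tau).
  by rewrite -[LHS]trmxK trmx_mul trmxK ST SuE tr_col_mx linearN /= !tr_col
    sigmaT tauT.
have qE : (u^T *m Sigma *m u) 0 0 = sigma m m + tau m m.
  rewrite uSE uE mul_row_col mulNmx mulmxN opprK -!colE.
  by rewrite !mxE.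
have detE : \det (1%:M - D *m Sigma) = 1 - d * (sigma m m + tau m m).
  (* Write [D *m Sigma] as the column [d *: u] times the row [u^T *m Sigma]; swapping the factors
     leaves a 1 x 1 determinant. *)
  rewrite DE -scalemxAl -mulmxA scalemxAl det_one_sub_mulmxC -scalemxAr.
  by rewrite [X in \det X]mx11_scalar det_scalar1 -qE; move: (_ *m u) => q;
    rewrite !mxE.
have WE : Sigma *m u *m (u^T *m Sigma) = block_mx W11 W12 W21 W22.
  rewrite SuE uSE mul_col_row; congr block_mx; apply/matrixP => k l;
    by rewrite ?(mulmxN, mulNmx) ?opprK !mxE big_ord1 !mxE.
have d_le0 : d <= 0.
  rewrite oppr_le0 mulr_ge0 ?(ltW (loss_prob_gt0 _ _)) //.
  by rewrite mulr_ge0 ?sqr_ge0 ?(ltW (win_prob_gt0 _ _)).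
(* Both diagonal entries are nonnegative by positive definiteness, so the subtracted product is at
   most 0. *)
have q0 : 1 - d * (sigma m m + tau m m) != 0.
  rewrite gt_eqF // subr_gt0 (le_lt_trans _ ltr01) // mulr_le0_ge0 //.
  by apply: addr_ge0; apply: sym_posdef_diag_ge0.
have NHE : - H *m (Sigma + W) = 1%:M.
  rewrite /W HE detE -WE DE -qE opprD opprK.
  by apply: mulmx_sherman_morrison; rewrite ?qE.
(* For square matrices a right inverse suffices: this gives both the invertibility of [H] and its
   inverse. *)
have HN : H *m - (Sigma + W) = 1%:M by rewrite mulmxN -mulNmx.
have [HU _] := mulmx1_unit HN.
split=> //; last by rewrite /d; ring.
by rewrite -[invmx H]mulmx1 -HN mulKmx // opprK.
Qed.
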